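(* Let $\mathsf{C}$ be a Markov category with conditionals such that $\mathsf{PS(C)}$ has all invariant objects (as for example $\mathsf{C}=\mathsf{BorelStoch}$). Let $M$ be a monoid and $D:M\to\mathsf{PS(C)}$ a dynamical system acting on the object $(X,p)$, with invariant object $(X_{\mathrm{inv}},p_{\mathrm{inv}})$ and colimiting cocone $r:(X,p)\to(X_{\mathrm{inv}},p_{\mathrm{inv}})$. Then the colimit $(X_{\mathrm{inv}},p_{\mathrm{inv}})$ is also the limit of $D$ in $\mathsf{PS(C)}$, with limiting cone given by $r^\dagger:(X_{\mathrm{inv}},p_{\mathrm{inv}})\to(X,p)$, the Bayesian inverse of $r$. That is, $m\circ r^\dagger\simeq_{p_{\mathrm{inv}}}r^\dagger$ for all $m\in M$, and for every morphism $g:(A,q)\to(X,p)$ of $\mathsf{PS(C)}$ with $m\circ g\simeq_q g$ for all $m\in M$ there is a unique (up to $q$-a.s. equality) morphism $\tilde g:(A,q)\to(X_{\mathrm{inv}},p_{\mathrm{inv}})$ with $g\simeq_q r^\dagger\circ\tilde g$.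
   Context: A Markov category is a symmetric monoidal category $(\mathsf{C},\otimes,I)$ with $I$ terminal, in which each object $X$ carries a commutative comonoid structure $\mathrm{copy}_X:X\to X\otimes X$, $\mathrm{del}_X:X\to I$, compatible with $\otimes$ (as usual for Markov categories). Coherence isomorphisms are suppressed. A state on $X$ is a morphism $p:I\to X$. Morphisms $f,g:X\to Y$ are $p$-a.s. equal, $f\simeq_p g$, if $(\mathrm{id}_X\otimes f)\,\mathrm{copy}_X\,p=(\mathrm{id}_X\otimes g)\,\mathrm{copy}_X\,p$. A morphism $f:X\to Y$ is $p$-a.s. deterministic if $(\mathrm{id}_X\otimes \mathrm{copy}_Y f)\,\mathrm{copy}_X\,p=(\mathrm{id}_X\otimes (f\otimes f)\mathrm{copy}_X)\,\mathrm{copy}_X\,p$. $\mathsf{C}$ has conditionals if for every $f:A\to X\otimes Y$ there is $f_{|X}:X\otimes A\to Y$ with $f=(\mathrm{id}_X\otimes f_{|X})(\mathrm{copy}_X\otimes\mathrm{id}_A)(f_X\otimes\mathrm{id}_A)\mathrm{copy}_A$, where $f_X=(\mathrm{id}_X\otimes\mathrm{del}_Y)f$. A Bayesian inverse of $f:X\to Y$ relative to $p$ is a morphism $f^\dagger:Y\to X$ with $(\mathrm{id}_X\otimes f)\,\mathrm{copy}_X\,p=(f^\dagger\otimes\mathrm{id}_Y)\,\mathrm{copy}_Y\,f\,p$; it is unique up to $(f\circ p)$-a.s. equality, and exists when $\mathsf{C}$ has conditionals. The category $\mathsf{PS(C)}$ has as objects pairs $(X,p)$ with $p$ a state on $X$;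 morphisms $(X,p)\to(Y,q)$ are morphisms $f:X\to Y$ of $\mathsf{C}$ with $f\circ p=q$, modulo $p$-a.s. equality (a Markov category with conditionals is causal, so composition is well defined). $\mathsf{BorelStoch}$ is the Markov category of standard Borel spaces and Markov kernels. A dynamical system $D:M\to\mathsf{PS(C)}$ acting on $(X,p)$ is a functor from the monoid $M$ (as a one-object category) sending the single object to $(X,p)$; the endomorphism induced by $m\in M$ is again denoted $m$. A morphism $f:(X,p)\to(Y,q)$ is $p$-a.s. invariant (right-invariant) if $f\circ m\simeq_p f$ for all $m\in M$. An invariant object for $D$ is an object $(X_{\mathrm{inv}},p_{\mathrm{inv}})$ with a morphism $r:(X,p)\to(X_{\mathrm{inv}},p_{\mathrm{inv}})$ of $\mathsf{PS(C)}$ such that: (i) it is a colimit of $D$ in $\mathsf{PS(C)}$, i.e. $r\circ m\simeq_p r$ for all $m$ and for every $p$-a.s. invariant $f:(X,p)\to(Y,q)$ there is a unique (up to $p_{\mathrm{inv}}$-a.s. equality) $\tilde f:(X_{\mathrm{inv}},p_{\mathrm{inv}})\to(Y,q)$ with $\tilde f\circ r\simeq_p f$; (ii) $f$ is $p$-a.s. deterministic if and only if $\tilde f$ is $p_{\mathrm{inv}}$-a.s. deterministic. ''$\mathsf{PS(C)}$ has all invariant objects'' means every dynamical system in $\mathsf{PS(C)}$, for every monoid, has an invariant object. *)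

(* Defs.v *)
From Stdlib Require Import Setoid Morphisms.

Set Implicit Arguments.
Unset Strict Implicit.
Unset Printing Implicit Defensive.

Declare Scope cat_scope.
Delimit Scope cat_scope with cat.
Local Open Scope cat_scope.

(* Each hom-type carries its own equality [heq], so that a category of
   morphisms modulo a congruence (such as almost sure equality) is again a
   [Category] without forming quotient types.  An ordinary category is the case
   where [heq] is Leibniz equality. *)
Record Category := {
  obj :> Type;
  hom : obj -> obj -> Type;
  heq : forall X Y, hom X Y -> hom X Y -> Prop;
  idm : forall X, hom X X;
  comp : forall X Y Z, hom Y Z -> hom X Y -> hom X Z;
  heq_equiv : forall X Y, Equivalence (@heq X Y);
  comp_proper : forall X Y Z,
    Proper (@heq Y Z ==> @heq X Y ==> @heq X Z) (@comp X Y Z);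
  compA : forall W X Y Z (h : hom Y Z) (g : hom X Y) (f : hom W X),
    heq (comp h (comp g f)) (comp (comp h g) f);
  comp1m : forall X Y (f : hom X Y), heq (comp (idm Y) f) f;
  compm1 : forall X Y (f : hom X Y), heq (comp f (idm X)) f
}.
Arguments heq {c X Y}.
Arguments idm {c} X.
Arguments comp {c X Y Z}.

#[export] Existing Instance heq_equiv.
#[export] Existing Instance comp_proper.

Notation "f ≈ g" := (heq f g) (at level 70, no associativity) : cat_scope.
Notation "g ∘ f" := (comp g f) (at level 40, left associativity) : cat_scope.

Record Functor (C D : Category) := {
  fobj :> C -> D;
  fmap : forall X Y : C, hom X Y -> hom (fobj X) (fobj Y);
  fmap_proper : forall X Y : C,
    Proper (heq ==> heq) (@fmap X Y);
  fmap1 : forall X : C, fmap (idm X) ≈ idm (fobj X);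
  fmapM : forall (X Y Z : C) (g : hom Y Z) (f : hom X Y),
    fmap (g ∘ f) ≈ fmap g ∘ fmap f
}.
Arguments fmap {C D} f0 {X Y}.

Record SymMonCategory := {
  smcat :> Category;
  tens : smcat -> smcat -> smcat;
  unit_obj : smcat;
  tensm : forall X X' Y Y' : smcat,
    hom X X' -> hom Y Y' -> hom (tens X Y) (tens X' Y');
  assoc : forall X Y Z : smcat, hom (tens (tens X Y) Z) (tens X (tens Y Z));
  assocV : forall X Y Z : smcat, hom (tens X (tens Y Z)) (tens (tens X Y) Z);
  unitl : forall X : smcat, hom (tens unit_obj X) X;
  unitlV : forall X : smcat, hom X (tens unit_obj X);
  unitr : forall X : smcat, hom (tens X unit_obj) X;
  unitrV : forall X : smcat, hom X (tens X unit_obj);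
  braid : forall X Y : smcat, hom (tens X Y) (tens Y X);

  tensm_proper : forall X X' Y Y' : smcat,
    Proper (heq ==> heq ==> heq) (@tensm X X' Y Y');
  tensm1 : forall X Y : smcat, tensm (idm X) (idm Y) ≈ idm (tens X Y);
  tensm_comp : forall (X X' X'' Y Y' Y'' : smcat)
      (f' : hom X' X'') (f : hom X X') (g' : hom Y' Y'') (g : hom Y Y'),
    tensm (f' ∘ f) (g' ∘ g) ≈ tensm f' g' ∘ tensm f g;

  assoc_nat : forall (X X' Y Y' Z Z' : smcat)
      (f : hom X X') (g : hom Y Y') (h : hom Z Z'),
    assoc X' Y' Z' ∘ tensm (tensm f g) h ≈ tensm f (tensm g h) ∘ assoc X Y Z;
  unitl_nat : forall (X Y : smcat) (f : hom X Y),
    unitl Y ∘ tensm (idm unit_obj) f ≈ f ∘ unitl X;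
  unitr_nat : forall (X Y : smcat) (f : hom X Y),
    unitr Y ∘ tensm f (idm unit_obj) ≈ f ∘ unitr X;
  braid_nat : forall (X X' Y Y' : smcat) (f : hom X X') (g : hom Y Y'),
    braid X' Y' ∘ tensm f g ≈ tensm g f ∘ braid X Y;

  assocVK : forall X Y Z : smcat, assoc X Y Z ∘ assocV X Y Z ≈ idm _;
  assocK : forall X Y Z : smcat, assocV X Y Z ∘ assoc X Y Z ≈ idm _;
  unitlVK : forall X : smcat, unitl X ∘ unitlV X ≈ idm _;
  unitlK : forall X : smcat, unitlV X ∘ unitl X ≈ idm _;
  unitrVK : forall X : smcat, unitr X ∘ unitrV X ≈ idm _;
  unitrK : forall X : smcat, unitrV X ∘ unitr X ≈ idm _;
  braidK : forall X Y : smcat, braid Y X ∘ braid X Y ≈ idm _;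

  pentagon : forall W X Y Z : smcat,
    tensm (idm W) (assoc X Y Z) ∘ assoc W (tens X Y) Z
      ∘ tensm (assoc W X Y) (idm Z)
    ≈ assoc W X (tens Y Z) ∘ assoc (tens W X) Y Z;
  triangle : forall X Y : smcat,
    tensm (idm X) (unitl Y) ∘ assoc X unit_obj Y ≈ tensm (unitr X) (idm Y);
  hexagon : forall X Y Z : smcat,
    assoc Y Z X ∘ braid X (tens Y Z) ∘ assoc X Y Z
    ≈ tensm (idm Y) (braid X Z) ∘ assoc Y X Z ∘ tensm (braid X Y) (idm Z)
}.
Arguments unit_obj {s}.
Arguments tensm {s X X' Y Y'}.
Arguments assoc {s} X Y Z.
Arguments assocV {s} X Y Z.
Arguments unitl {s} X.
Arguments unitlV {s} X.
Arguments unitr {s} X.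
Arguments unitrV {s} X.
Arguments braid {s} X Y.

#[export] Existing Instance tensm_proper.

Notation "X ⊠ Y" := (tens X Y) (at level 38, right associativity) : cat_scope.
Notation "f ⊗ g" := (tensm f g) (at level 38, right associativity) : cat_scope.

(* The exchange of the two inner factors,
   (X ⊠ Y) ⊠ (Z ⊠ W) -> (X ⊠ Z) ⊠ (Y ⊠ W). *)
Definition mid_swap (C : SymMonCategory) (X Y Z W : C) :
    hom ((X ⊠ Y) ⊠ (Z ⊠ W)) ((X ⊠ Z) ⊠ (Y ⊠ W)) :=
  assocV X Z (Y ⊠ W)
  ∘ (idm X ⊗ (assoc Z Y W ∘ (braid Y Z ⊗ idm W) ∘ assocV Y Z W))
  ∘ assoc X Y (Z ⊠ W).

(* Compatibility of [del] with ⊠ and the equation copy_I = unitlV I are not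
   listed: they follow from terminality of I and the counit laws. *)
Record MarkovCategory := {
  mksm :> SymMonCategory;
  copy : forall X : mksm, hom X (X ⊠ X);
  del : forall X : mksm, hom X unit_obj;
  unit_terminal : forall (X : mksm) (f g : hom X unit_obj), f ≈ g;
  copy_assoc : forall X : mksm,
    assoc X X X ∘ (copy X ⊗ idm X) ∘ copy X ≈ (idm X ⊗ copy X) ∘ copy X;
  copy_unitl : forall X : mksm, unitl X ∘ (del X ⊗ idm X) ∘ copy X ≈ idm X;
  copy_unitr : forall X : mksm, unitr X ∘ (idm X ⊗ del X) ∘ copy X ≈ idm X;
  copy_comm : forall X : mksm, braid X X ∘ copy X ≈ copy X;
  copy_tens : forall X Y : mksm,
    copy (X ⊠ Y) ≈ mid_swap X X Y Y ∘ (copy X ⊗ copy Y)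
}.
Arguments copy {m} X.
Arguments del {m} X.

Section Markov.
Variable C : MarkovCategory.

Definition state (X : C) := hom (unit_obj : C) X.

Definition as_eq (X Y : C) (p : state X) (f g : hom X Y) : Prop :=
  (idm X ⊗ f) ∘ copy X ∘ p ≈ (idm X ⊗ g) ∘ copy X ∘ p.

Definition as_deterministic (X Y : C) (p : state X) (f : hom X Y) : Prop :=
  (idm X ⊗ (copy Y ∘ f)) ∘ copy X ∘ p
  ≈ (idm X ⊗ ((f ⊗ f) ∘ copy X)) ∘ copy X ∘ p.

Definition marginal (A X Y : C) (f : hom A (X ⊠ Y)) : hom A X :=
  unitr X ∘ (idm X ⊗ del Y) ∘ f.

Definition is_conditional (A X Y : C) (f : hom A (X ⊠ Y))
    (c : hom (X ⊠ A) Y) : Prop :=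
  f ≈ (idm X ⊗ c) ∘ assoc X X A ∘ (copy X ⊗ idm A)
      ∘ (marginal f ⊗ idm A) ∘ copy A.

Definition has_conditionals : Prop :=
  forall (A X Y : C) (f : hom A (X ⊠ Y)), exists c, is_conditional f c.

Definition is_bayesian_inverse (X Y : C) (p : state X) (f : hom X Y)
    (fd : hom Y X) : Prop :=
  (idm X ⊗ f) ∘ copy X ∘ p ≈ (fd ⊗ idm Y) ∘ copy Y ∘ (f ∘ p).

Lemma tensm_idl (X Y Y' Y'' : C) (g : hom Y' Y'') (f : hom Y Y') :
  idm X ⊗ (g ∘ f) ≈ (idm X ⊗ g) ∘ (idm X ⊗ f).
Proof. rewrite <- tensm_comp, comp1m; reflexivity. Qed.

Lemma tensm_idr (X Y Y' Y'' : C) (g : hom Y' Y'') (f : hom Y Y') :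
  (g ∘ f) ⊗ idm X ≈ (g ⊗ idm X) ∘ (f ⊗ idm X).
Proof. rewrite <- tensm_comp, comp1m; reflexivity. Qed.

Lemma tensm_swap (X X' Y Y' : C) (f : hom X X') (g : hom Y Y') :
  (idm X' ⊗ g) ∘ (f ⊗ idm Y) ≈ (f ⊗ idm Y') ∘ (idm X ⊗ g).
Proof. rewrite <- !tensm_comp, !comp1m, !compm1; reflexivity. Qed.

Lemma unitrV_nat (X Y : C) (f : hom X Y) :
  (f ⊗ idm unit_obj) ∘ unitrV X ≈ unitrV Y ∘ f.
Proof.
rewrite <- (comp1m ((f ⊗ _) ∘ _)), <- (unitrK Y), <- compA.
rewrite (compA (unitr Y)), unitr_nat, <- compA, unitrVK, compm1; reflexivity.
Qed.

Lemma unitr_tens (X Y : C) :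
  (idm X ⊗ unitr Y) ∘ assoc X Y unit_obj ≈ unitr (X ⊠ Y).
Proof.
assert (H : ((idm X ⊗ unitr Y) ∘ assoc X Y unit_obj) ⊗ idm (unit_obj : C)
            ≈ unitr (X ⊠ Y) ⊗ idm (unit_obj : C)).
{ rewrite <- (comp1m (unitr (X ⊠ Y) ⊗ _)), <- (comp1m (_ ⊗ idm unit_obj)).
  rewrite <- (assocK X Y unit_obj), <- !compA.
  apply comp_proper; [reflexivity|].
  rewrite <- triangle, <- (tensm1 X Y), (compA (assoc X Y unit_obj)).
  rewrite assoc_nat, <- compA, <- pentagon.
  rewrite tensm_idr, !compA, assoc_nat, <- tensm_idl, triangle; reflexivity. }
rewrite <- (compm1 (_ ∘ assoc X Y unit_obj)), <- (compm1 (unitr (X ⊠ Y))).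
rewrite <- (unitrVK ((X ⊠ Y) ⊠ unit_obj)), !(compA _ (unitr _) (unitrV _)).
rewrite <- !unitr_nat, H; reflexivity.
Qed.

Lemma copy_unit : copy (unit_obj : C) ≈ unitrV unit_obj.
Proof.
rewrite <- (comp1m (copy _)), <- (unitrK unit_obj), <- compA.
rewrite <- (comp1m (copy _)), <- tensm1.
rewrite (unit_terminal (idm unit_obj) (del unit_obj)) at 2.
rewrite (compA (unitr _)), copy_unitr, compm1; reflexivity.
Qed.

Lemma bayesian_inverse_exists (X Y : C) (p : state X) (f : hom X Y) :
  has_conditionals -> exists fd, is_bayesian_inverse p f fd.
Proof.
intros HC; destruct (HC _ _ _ ((f ⊗ idm X) ∘ copy X ∘ p)) as [c Hc].
exists (c ∘ unitrV Y); unfold is_bayesian_inverse, is_conditional in *.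
assert (Hm : marginal ((f ⊗ idm X) ∘ copy X ∘ p) ≈ f ∘ p).
{ unfold marginal; rewrite !compA, <- (compA (unitr Y)), tensm_swap.
  rewrite compA, unitr_nat, <- !(compA f), copy_unitr, comp1m; reflexivity. }
rewrite Hm, copy_unit in Hc.
rewrite <- (compA _ (_ ⊗ _) (unitrV _)), unitrV_nat in Hc.
rewrite (compA _ (unitrV Y)) in Hc.
rewrite <- (compA _ (copy Y ⊗ _)), unitrV_nat in Hc.
assert (Hu : assoc Y Y unit_obj ∘ unitrV (Y ⊠ Y) ≈ idm Y ⊗ unitrV Y).
{ rewrite <- (comp1m (assoc _ _ _ ∘ _)), <- (tensm1 Y (Y ⊠ _)).
  rewrite <- (unitrK Y), tensm_idl, <- compA, (compA (_ ⊗ unitr Y)).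
  rewrite unitr_tens, unitrVK, compm1; reflexivity. }
rewrite (compA _ (unitrV (Y ⊠ Y))) in Hc.
rewrite <- (compA _ (assoc Y Y unit_obj)), Hu, <- tensm_idl in Hc.
rewrite <- copy_comm at 1; rewrite compA, <- braid_nat, <- !compA.
rewrite (compA (f ⊗ _)), Hc.
rewrite !compA, braid_nat, <- (compA _ (braid Y Y)), copy_comm; reflexivity.
Qed.

Lemma bayesian_inverse_state (X Y : C) (p : state X) (f : hom X Y)
    (fd : hom Y X) : is_bayesian_inverse p f fd -> fd ∘ (f ∘ p) ≈ p.
Proof.
unfold is_bayesian_inverse; intros H.
assert (E : unitr X ∘ (idm X ⊗ del Y) ∘ ((idm X ⊗ f) ∘ copy X ∘ p) ≈ p).
{ rewrite !compA, <- (compA (unitr X)), <- tensm_idl.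
  rewrite (unit_terminal (del Y ∘ f) (del X)), copy_unitr, comp1m; reflexivity. }
rewrite <- E at 2; rewrite H, !compA, <- (compA (unitr X)), tensm_swap.
rewrite compA, unitr_nat, <- !(compA fd), copy_unitr, comp1m; reflexivity.
Qed.

Lemma as_eq_equiv (X Y : C) (p : state X) : Equivalence (@as_eq X Y p).
Proof.
unfold as_eq; split.
- intros f; reflexivity.
- intros f g; symmetry; assumption.
- intros f g h; apply transitivity.
Qed.

Lemma heq_as_eq (X Y : C) (p : state X) (f g : hom X Y) :
  f ≈ g -> as_eq p f g.
Proof. unfold as_eq; intros E; rewrite E; reflexivity. Qed.

Lemma as_eq_comp (X Y Z : C) (p : state X) (q : state Y)
    (f f' : hom X Y) (g g' : hom Y Z) :
  has_conditionals -> f' ∘ p ≈ q ->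
  as_eq q g g' -> as_eq p f f' -> as_eq p (g ∘ f) (g' ∘ f').
Proof.
unfold as_eq; intros HC Hq Hg Hf.
destruct (bayesian_inverse_exists p f' HC) as [h Hh].
unfold is_bayesian_inverse in Hh.
rewrite !tensm_idl, <- !compA, !(compA _ (copy X) p), Hf, Hh, Hq.
rewrite !compA, !tensm_swap, <- !compA, !(compA _ (copy Y) q), Hg; reflexivity.
Qed.

Record ps_obj := PsObj { ps_carrier :> C; ps_state : state ps_carrier }.

Record ps_hom (X Y : ps_obj) := PsHom {
  ps_mor :> hom X Y;
  ps_morP : ps_mor ∘ ps_state X ≈ ps_state Y
}.

Definition ps_heq (X Y : ps_obj) (f g : ps_hom X Y) : Prop :=
  as_eq (ps_state X) f g.

Definition ps_id (X : ps_obj) : ps_hom X X := PsHom (comp1m (ps_state X)).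

Lemma ps_comp_subproof (X Y Z : ps_obj) (g : ps_hom Y Z) (f : ps_hom X Y) :
  g ∘ f ∘ ps_state X ≈ ps_state Z.
Proof. rewrite <- compA, ps_morP, ps_morP; reflexivity. Qed.

Definition ps_comp (X Y Z : ps_obj) (g : ps_hom Y Z) (f : ps_hom X Y) :
  ps_hom X Z := PsHom (ps_comp_subproof g f).

Lemma ps_heq_equiv (X Y : ps_obj) : Equivalence (@ps_heq X Y).
Proof.
destruct (@as_eq_equiv X Y (ps_state X)) as [r s t].
split; [intros f; apply r | intros f g; apply s | intros f g h; apply t].
Qed.

Lemma ps_comp_proper (HC : has_conditionals) (X Y Z : ps_obj) :
  Proper (@ps_heq Y Z ==> @ps_heq X Y ==> @ps_heq X Z) (@ps_comp X Y Z).
Proof.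
intros g g' Hg f f' Hf; exact (as_eq_comp HC (ps_morP f') Hg Hf).
Qed.

(* [HC] is what makes composition respect almost sure equality. *)
Definition PS (HC : has_conditionals) : Category := {|
  obj := ps_obj;
  hom := ps_hom;
  heq := ps_heq;
  idm := ps_id;
  comp := ps_comp;
  heq_equiv := ps_heq_equiv;
  comp_proper := ps_comp_proper HC;
  compA := fun W X Y Z (h : ps_hom Y Z) (g : ps_hom X Y) (f : ps_hom W X) =>
    heq_as_eq (ps_state W) (compA h g f);
  comp1m := fun X Y (f : ps_hom X Y) => heq_as_eq (ps_state X) (comp1m f);
  compm1 := fun X Y (f : ps_hom X Y) => heq_as_eq (ps_state X) (compm1 f)
|}.

End Markov.

(* Unlike for [monoidType], no choice structure on the carrier is required. *)
Record Monoid := {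
  mon_car :> Type;
  mon_one : mon_car;
  mon_mul : mon_car -> mon_car -> mon_car;
  mon_mulA : forall x y z,
    mon_mul x (mon_mul y z) = mon_mul (mon_mul x y) z;
  mon_mul1 : forall x, mon_mul mon_one x = x;
  mon_mulr1 : forall x, mon_mul x mon_one = x
}.

Definition one_object_category (M : Monoid) : Category := {|
  obj := unit;
  hom := fun _ _ => M;
  heq := fun _ _ => @eq M;
  idm := fun _ => mon_one M;
  comp := fun _ _ _ => @mon_mul M;
  heq_equiv := fun _ _ => eq_equivalence;
  comp_proper := fun _ _ _ => _;
  compA := fun _ _ _ _ => @mon_mulA M;
  comp1m := fun _ _ => @mon_mul1 M;
  compm1 := fun _ _ => @mon_mulr1 M
|}.

Section DynamicalSystems.
Variables (C : MarkovCategory) (HC : has_conditionals C).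

(* The object (X,p) acted upon is [acted D]. *)
Definition DynamicalSystem (M : Monoid) : Type :=
  Functor (one_object_category M) (PS HC).

Variables (M : Monoid) (D : DynamicalSystem M).

Definition acted : PS HC := D tt.

Definition act (m : M) : hom acted acted :=
  @fmap (one_object_category M) (PS HC) D tt tt m.

Definition right_invariant (Y : PS HC) (f : hom acted Y) : Prop :=
  forall m : M, f ∘ act m ≈ f.

Definition left_invariant (A : PS HC) (g : hom A acted) : Prop :=
  forall m : M, act m ∘ g ≈ g.

Definition is_colimit (L : PS HC) (r : hom acted L) : Prop :=
  right_invariant r /\
  forall (Y : PS HC) (f : hom acted Y), right_invariant f ->
    exists ft : hom L Y, ft ∘ r ≈ f /\
      forall ft' : hom L Y, ft' ∘ r ≈ f -> ft' ≈ ft.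

Definition is_limit (L : PS HC) (s : hom L acted) : Prop :=
  left_invariant s /\
  forall (A : PS HC) (g : hom A acted), left_invariant g ->
    exists gt : hom A L, g ≈ s ∘ gt /\
      forall gt' : hom A L, g ≈ s ∘ gt' -> gt' ≈ gt.

Definition ps_deterministic (X Y : PS HC) (f : hom X Y) : Prop :=
  as_deterministic (ps_state X) (ps_mor f).

Definition is_invariant_object (L : PS HC) (r : hom acted L) : Prop :=
  is_colimit r /\
  forall (Y : PS HC) (f : hom acted Y) (ft : hom L Y),
    right_invariant f -> ft ∘ r ≈ f ->
    (ps_deterministic f <-> ps_deterministic ft).

End DynamicalSystems.
Arguments is_colimit {C HC M} D {L} r.
Arguments is_limit {C HC M} D {L} s.
Arguments is_invariant_object {C HC M} D {L} r.

Definition has_all_invariant_objects (C : MarkovCategory)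
    (HC : has_conditionals C) : Prop :=
  forall (M : Monoid) (D : DynamicalSystem HC M),
    exists (L : PS HC) (r : hom (acted D) L), is_invariant_object D r.

Definition ps_bayesian_inverse (C : MarkovCategory) (HC : has_conditionals C)
    (X Y : PS HC) (f : hom X Y) (fd : hom Y X) : Prop :=
  is_bayesian_inverse (ps_state X) (ps_mor f) (ps_mor fd).

Lemma ps_bayesian_inverse_exists (C : MarkovCategory)
    (HC : has_conditionals C) (X Y : PS HC) (f : hom X Y) :
  exists fd : hom Y X, ps_bayesian_inverse f fd.
Proof.
destruct (bayesian_inverse_exists (ps_state X) (ps_mor f) HC) as [fd H].
assert (E : fd ∘ ps_state Y ≈ ps_state X).
{ rewrite <- (ps_morP f); exact (bayesian_inverse_state H). }
exists (PsHom E); exact H.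
Qed.

(* Main.v *)
(** Bayesian inversion is a dagger on PS(C): it reverses composites, is
    involutive, and respects almost sure equality.  It therefore exchanges
    colimits with limits, but replaces each [m] by its inverse [m^†].  What
    remains is that [f m ≃ f] is equivalent to [f m^† ≃ f].  Factoring [f]
    through the invariant object of the system generated by [m] alone, one may
    take [f] to be its cocone [r], which is almost surely deterministic because
    the identity is.  For such [r], conditionals upgrade [r m ≃ r] to
    [(r(m x), m x) ≃ (r x, m x)], and invariance of the state turns the
    resulting equality of laws into [r m^† ≃ r]. *)

From Stdlib Require Import Setoid Morphisms PeanoNat.
Require Import Defs.

Set Implicit Arguments.
Unset Strict Implicit.
Unset Printing Implicit Defensive.

Local Open Scope cat_scope.

(** * Pairings of morphisms and almost sure equality *)

Section Pairing.
Variable C : MarkovCategory.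

(** Not a universal pairing: precomposing with a random [h] does not distribute over the components,
    since [f] and [g] then share one sample of [h]. *)
Definition pair_mor (A X Y : C) (f : hom A X) (g : hom A Y) : hom A (X ⊠ Y) :=
  (f ⊗ g) ∘ copy A.

#[export] Instance pair_mor_proper (A X Y : C) :
  Proper (heq ==> heq ==> heq) (@pair_mor A X Y).
Proof.
intros f f' Hf g g' Hg; unfold pair_mor; rewrite Hf, Hg; reflexivity.
Qed.

Lemma tensm_pair (A X X' Y Y' : C) (h : hom X X') (k : hom Y Y')
    (f : hom A X) (g : hom A Y) :
  (h ⊗ k) ∘ pair_mor f g ≈ pair_mor (h ∘ f) (k ∘ g).
Proof. unfold pair_mor; rewrite compA, <- tensm_comp; reflexivity. Qed.

Lemma braid_pair (A X Y : C) (f : hom A X) (g : hom A Y) :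
  braid X Y ∘ pair_mor f g ≈ pair_mor g f.
Proof.
unfold pair_mor; rewrite compA, braid_nat, <- compA, copy_comm; reflexivity.
Qed.

Lemma assoc_pair (A X Y Z : C) (f : hom A X) (g : hom A Y) (h : hom A Z) :
  assoc X Y Z ∘ pair_mor (pair_mor f g) h ≈ pair_mor f (pair_mor g h).
Proof.
unfold pair_mor.
rewrite <- (compm1 h) at 1; rewrite tensm_comp, !compA, assoc_nat.
rewrite <- (compA (f ⊗ _)), <- (compA (f ⊗ _)), copy_assoc, compA.
rewrite <- tensm_comp, compm1; reflexivity.
Qed.

Lemma pair_fst (A X Y : C) (f : hom A X) (g : hom A Y) :
  unitr X ∘ (idm X ⊗ del Y) ∘ pair_mor f g ≈ f.
Proof.
rewrite <- compA, tensm_pair, comp1m.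
rewrite (unit_terminal (del Y ∘ g) (del A)); unfold pair_mor.
rewrite <- (compm1 f) at 1; rewrite <- (comp1m (del A)), tensm_comp, !compA.
rewrite unitr_nat, <- !(compA f), copy_unitr, compm1; reflexivity.
Qed.

Lemma pair_snd (A X Y : C) (f : hom A X) (g : hom A Y) :
  unitl Y ∘ (del X ⊗ idm Y) ∘ pair_mor f g ≈ g.
Proof.
rewrite <- compA, tensm_pair, comp1m.
rewrite (unit_terminal (del X ∘ f) (del A)); unfold pair_mor.
rewrite <- (compm1 g) at 1; rewrite <- (comp1m (del A)), tensm_comp, !compA.
rewrite unitl_nat, <- !(compA g), copy_unitl, compm1; reflexivity.
Qed.

Lemma assocV_pair (A X Y Z : C) (f : hom A X) (g : hom A Y) (h : hom A Z) :
  assocV X Y Z ∘ pair_mor f (pair_mor g h) ≈ pair_mor (pair_mor f g) h.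
Proof. rewrite <- assoc_pair, compA, assocK, comp1m; reflexivity. Qed.

Section AlmostSure.
Variables (X : C) (p : state X).

Lemma as_eq_comp_l (Y Z : C) (h : hom Y Z) (f g : hom X Y) :
  as_eq p f g -> as_eq p (h ∘ f) (h ∘ g).
Proof.
unfold as_eq; intros E.
rewrite !tensm_idl, <- !compA, !(compA _ (copy X) p), E; reflexivity.
Qed.

Lemma as_eq_state_pair (Y Z : C) (f g : hom X Y) (h : hom X Z) :
  as_eq p f g -> pair_mor f h ∘ p ≈ pair_mor g h ∘ p.
Proof.
unfold as_eq; fold (pair_mor (idm X) f) (pair_mor (idm X) g); intros E.
assert (F : forall k : hom X Y,
  pair_mor k h ≈ braid _ _ ∘ (h ⊗ idm _) ∘ pair_mor (idm X) k).
{ intros k; rewrite <- compA, tensm_pair, braid_pair, comp1m, compm1.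
  reflexivity. }
rewrite !F, <- !(compA _ _ p), E; reflexivity.
Qed.

Lemma as_eq_pair (Y Z : C) (f g : hom X Y) (h : hom X Z) :
  as_eq p f g -> as_eq p (pair_mor f h) (pair_mor g h).
Proof.
intros E; unfold as_eq.
fold (pair_mor (idm X) (pair_mor f h)) (pair_mor (idm X) (pair_mor g h)).
rewrite <- !(braid_pair _ (idm X)), <- !assocV_pair, <- !(compA _ _ p).
rewrite (as_eq_state_pair _ E); reflexivity.
Qed.

(* The conditional [c] of [y] given [(r y, x)], where [y] is drawn from [m x],
   gives [(r(m x), m x) ≃ (r x, c(r x, x))] as soon as [r m ≃ r] and [r] may be
   copied; comparing second components, [c(r x, x) ≃ m x]. *)
Lemma deterministic_invariant_pair (Y : C) (r : hom X Y) (m : hom X X) :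
  has_conditionals C -> as_deterministic p r -> as_eq p (r ∘ m) r ->
  as_eq p (pair_mor r (idm X) ∘ m) (pair_mor r m).
Proof.
intros HC Hdet Hrm.
destruct (HC _ _ _ (pair_mor r (idm X) ∘ m)) as [c Hc].
unfold is_conditional in Hc.
assert (Hmarg : marginal (pair_mor r (idm X) ∘ m) ≈ r ∘ m).
{ unfold marginal; rewrite compA, pair_fst; reflexivity. }
rewrite Hmarg in Hc.
rewrite <- (compA _ _ (copy X)) in Hc; fold (pair_mor (r ∘ m) (idm X)) in Hc.
assert (Hf : as_eq p (pair_mor r (idm X) ∘ m)
                     (pair_mor r (c ∘ pair_mor r (idm X)))).
{ pose proof (as_eq_equiv (Y ⊠ X) p).
  etransitivity; [exact (heq_as_eq p Hc)|].
  etransitivity; [exact (as_eq_comp_l _ (as_eq_pair _ Hrm))|].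
  etransitivity.
  { apply heq_as_eq; rewrite <- compA, tensm_pair, comp1m; reflexivity. }
  etransitivity.
  (* [Hdet] is almost sure equality of [copy Y ∘ r] and [pair_mor r r]: a shared sample of [r x]
     becomes two independent ones. *)
  { apply as_eq_comp_l, as_eq_pair; exact Hdet. }
  apply heq_as_eq; fold (pair_mor r r).
  rewrite <- compA, assoc_pair, tensm_pair, comp1m; reflexivity. }
assert (Hm : as_eq p m (c ∘ pair_mor r (idm X))).
{ apply (as_eq_comp_l (unitl X ∘ (del Y ⊗ idm X))) in Hf.
  pose proof (as_eq_equiv X p).
  etransitivity; [apply heq_as_eq|etransitivity; [exact Hf|apply heq_as_eq]].
  - rewrite compA, pair_snd, comp1m; reflexivity.
  - rewrite pair_snd; reflexivity. }
pose proof (as_eq_equiv (Y ⊠ X) p).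
etransitivity; [exact Hf|]; symmetry.
etransitivity; [apply heq_as_eq; symmetry; apply braid_pair|].
etransitivity; [|apply heq_as_eq, braid_pair].
apply as_eq_comp_l, as_eq_pair; exact Hm.
Qed.

Lemma as_eq_state (Y : C) (f g : hom X Y) : as_eq p f g -> f ∘ p ≈ g ∘ p.
Proof.
intros E; rewrite <- (pair_fst f (idm X)), <- (pair_fst g (idm X)).
rewrite <- !(compA _ _ p), (as_eq_state_pair (idm X) E); reflexivity.
Qed.

Lemma bayesian_inverse_pair (Y : C) (f : hom X Y) (fd : hom Y X) :
  is_bayesian_inverse p f fd <->
  pair_mor (idm X) f ∘ p ≈ pair_mor fd (idm Y) ∘ (f ∘ p).
Proof. reflexivity. Qed.

(** For [x] of law [p], Bayes gives [(r (md x), x)] the law of [(r x, m x)]. By the pair lemma this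
    is the law of [(r y, y)] with [y] drawn from [m x], and [y] again has law [p]. *)
Lemma deterministic_invariant_bayesian_inverse (Y : C) (r : hom X Y)
    (m md : hom X X) :
  has_conditionals C -> as_deterministic p r -> m ∘ p ≈ p ->
  is_bayesian_inverse p m md -> as_eq p (r ∘ m) r -> as_eq p (r ∘ md) r.
Proof.
intros HC Hdet Hp Hmd Hrm.
rewrite bayesian_inverse_pair, Hp in Hmd.
pose proof (as_eq_state (deterministic_invariant_pair HC Hdet Hrm)) as E.
unfold as_eq; fold (pair_mor (idm X) (r ∘ md)) (pair_mor (idm X) r).
rewrite <- !(braid_pair _ (idm X)), <- !(compA _ _ p).
apply comp_proper; [reflexivity|].
transitivity ((r ⊗ idm X) ∘ (pair_mor md (idm X) ∘ p)).
{ rewrite compA, tensm_pair, comp1m; reflexivity. }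
rewrite <- Hmd, compA, tensm_pair, comp1m, compm1, <- E, <- compA, Hp.
reflexivity.
Qed.

End AlmostSure.

Lemma as_deterministic_id (X : C) (p : state X) : as_deterministic p (idm X).
Proof.
apply heq_as_eq; rewrite compm1, tensm1, comp1m; reflexivity.
Qed.

End Pairing.

(** * Bayesian inversion as a dagger on [PS HC] *)

Section Dagger.
Variables (C : MarkovCategory) (HC : has_conditionals C).

Lemma ps_bayesian_inverse_pair (X Y : PS HC) (f : hom X Y) (fd : hom Y X) :
  ps_bayesian_inverse f fd <->
  pair_mor (idm (ps_carrier X)) (ps_mor f) ∘ ps_state X
  ≈ pair_mor (ps_mor fd) (idm (ps_carrier Y)) ∘ ps_state Y.
Proof.
unfold ps_bayesian_inverse; rewrite bayesian_inverse_pair, (ps_morP f).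
reflexivity.
Qed.

Lemma ps_bayesian_inverse_sym (X Y : PS HC) (f : hom X Y) (fd : hom Y X) :
  ps_bayesian_inverse f fd -> ps_bayesian_inverse fd f.
Proof.
rewrite !ps_bayesian_inverse_pair; intros H.
rewrite <- (braid_pair (ps_mor fd)), <- compA, <- H, compA, braid_pair.
reflexivity.
Qed.

(** Both joint laws equal [pair_mor fd g] on the state of [Y]. *)
Lemma ps_bayesian_inverse_comp (X Y Z : PS HC) (f : hom X Y) (fd : hom Y X)
    (g : hom Y Z) (gd : hom Z Y) :
  ps_bayesian_inverse f fd -> ps_bayesian_inverse g gd ->
  ps_bayesian_inverse (g ∘ f) (fd ∘ gd).
Proof.
rewrite !ps_bayesian_inverse_pair; intros Hf Hg; simpl.
rewrite <- (comp1m (idm (ps_carrier X))), <- (comp1m (idm (ps_carrier Z))).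
rewrite <- !tensm_pair, <- !compA, Hf, <- Hg, !compA, !tensm_pair.
rewrite !comp1m, !compm1; reflexivity.
Qed.

(** The joint law of [f] and its input determines [fd] almost surely. Besides uniqueness, this
    transports equations across the dagger. *)
Lemma ps_bayesian_inverse_unique (X Y : PS HC) (f g : hom X Y)
    (fd gd : hom Y X) :
  ps_bayesian_inverse f fd -> ps_bayesian_inverse g gd -> f ≈ g -> fd ≈ gd.
Proof.
rewrite !ps_bayesian_inverse_pair; intros Hf Hg E.
change (pair_mor (idm (ps_carrier X)) (ps_mor f) ∘ ps_state X
        ≈ pair_mor (idm (ps_carrier X)) (ps_mor g) ∘ ps_state X) in E.
change (pair_mor (idm (ps_carrier Y)) (ps_mor fd) ∘ ps_state Y
        ≈ pair_mor (idm (ps_carrier Y)) (ps_mor gd) ∘ ps_state Y).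
rewrite <- !(braid_pair _ (idm (ps_carrier Y))), <- !compA, <- Hf, <- Hg, E.
reflexivity.
Qed.

(** * Systems generated by one endomorphism *)

Definition nat_monoid : Monoid := {|
  mon_car := nat;
  mon_one := 0;
  mon_mul := Nat.add;
  mon_mulA := Nat.add_assoc;
  mon_mul1 := Nat.add_0_l;
  mon_mulr1 := Nat.add_0_r
|}.

Fixpoint iter_mor (X : PS HC) (m : hom X X) (n : nat) : hom X X :=
  match n with 0 => idm X | S n => m ∘ iter_mor m n end.

Lemma iter_mor_add (X : PS HC) (m : hom X X) (k n : nat) :
  iter_mor m (k + n) ≈ iter_mor m k ∘ iter_mor m n.
Proof.
induction k as [|k IH]; cbn [iter_mor Nat.add].
- symmetry; apply (comp1m (c := PS HC)).
- rewrite IH; apply (compA (c := PS HC)).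
Qed.

Definition iter_system (X : PS HC) (m : hom X X) :
    DynamicalSystem HC nat_monoid :=
  {| fobj := fun _ : one_object_category nat_monoid => X;
     fmap := fun _ _ (n : nat) => iter_mor m n;
     fmap_proper := fun _ _ k n E => match E with eq_refl => reflexivity _ end;
     fmap1 := fun _ => reflexivity _;
     fmapM := fun _ _ _ k n => iter_mor_add m k n |}.

Lemma iter_system_invariant (X Y : PS HC) (m : hom X X) (f : hom X Y) :
  right_invariant (D := iter_system m) f <-> f ∘ m ≈ f.
Proof.
split.
- intros H; rewrite <- (H 1) at 2; apply comp_proper; [reflexivity|].
  symmetry; apply (compm1 (c := PS HC)).
- intros H n; induction n as [|n IH].
  + apply (compm1 (c := PS HC)).
  + change (f ∘ (m ∘ iter_mor m n) ≈ f).
    rewrite (compA (c := PS HC)), H; exact IH.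
Qed.

Lemma invariant_bayesian_inverse (Hinv : has_all_invariant_objects HC)
    (X Y : PS HC) (m md : hom X X) (f : hom X Y) :
  ps_bayesian_inverse m md -> f ∘ m ≈ f -> f ∘ md ≈ f.
Proof.
intros Hmd Hf.
destruct (Hinv _ (iter_system m)) as (L & r & [Hr Hcolim] & Hdet).
destruct (Hcolim Y f) as (h & Hh & _); [apply iter_system_invariant, Hf|].
assert (Hr_det : ps_deterministic r).
(* The cocone [r] factors through itself by the identity. *)
{ apply (Hdet L r (idm L) Hr); [apply (comp1m (c := PS HC))|].
  apply as_deterministic_id. }
assert (Hrmd : r ∘ md ≈ r).
{ apply iter_system_invariant in Hr.
  exact (deterministic_invariant_bayesian_inverse HC Hr_det (ps_morP m) Hmd Hr). }
rewrite <- Hh.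
transitivity (h ∘ (r ∘ md)); [symmetry; apply (compA (c := PS HC))|].
rewrite Hrmd; reflexivity.
Qed.

End Dagger.

Theorem theorem3p19 (C : MarkovCategory) (HC : has_conditionals C)
    (Hinv : has_all_invariant_objects HC)
    (M : Monoid) (D : DynamicalSystem HC M)
    (Xinv : PS HC) (r : hom (acted D) Xinv) (Hr : is_invariant_object D r)
    (rdag : hom Xinv (acted D)) (Hrdag : ps_bayesian_inverse r rdag) :
  is_limit D rdag.
Proof.
destruct Hr as [[Hr Hcolim] _]; split.
- intros m; destruct (ps_bayesian_inverse_exists (act D m)) as [md Hmd].
  (* [act D m ∘ rdag] inverts [r ∘ md], so the claim reduces to [r ∘ md ≈ r]. *)
  apply (ps_bayesian_inverse_unique (f := r ∘ md) (g := r)); [|exact Hrdag|].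
  + exact (ps_bayesian_inverse_comp (ps_bayesian_inverse_sym Hmd) Hrdag).
  + exact (invariant_bayesian_inverse Hinv Hmd (Hr m)).
- intros A g Hg; destruct (ps_bayesian_inverse_exists g) as [gd Hgd].
  destruct (Hcolim A gd) as (h & Hh & Huniq).
  (* Inverting [act D m ∘ g ≈ g] gives [gd ∘ md ≈ gd]; as [act D m] is an inverse of [md],
     invariance passes back to [act D m]. *)
  { intros m; destruct (ps_bayesian_inverse_exists (act D m)) as [md Hmd].
    apply (invariant_bayesian_inverse Hinv (ps_bayesian_inverse_sym Hmd)).
    apply (ps_bayesian_inverse_unique (f := act D m ∘ g) (g := g));
      [|exact Hgd|exact (Hg m)].
    exact (ps_bayesian_inverse_comp Hgd Hmd). }
  destruct (ps_bayesian_inverse_exists h) as [hd Hhd].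
  (* Inverting the factorization [h ∘ r ≈ gd] gives [rdag ∘ hd ≈ g]. *)
  exists hd; split.
  + apply (ps_bayesian_inverse_unique (f := gd) (g := h ∘ r)).
    * exact (ps_bayesian_inverse_sym Hgd).
    * exact (ps_bayesian_inverse_comp Hrdag Hhd).
    * symmetry; exact Hh.
  (* The inverse of any competitor [g'] factors [gd] through [r], so it agrees with [h]. *)
  + intros g' Hg'; destruct (ps_bayesian_inverse_exists g') as [g'd Hg'd].
    apply (ps_bayesian_inverse_unique (f := g'd) (g := h));
      [exact (ps_bayesian_inverse_sym Hg'd)|exact Hhd|].
    apply Huniq; symmetry.
    apply (ps_bayesian_inverse_unique Hgd
      (ps_bayesian_inverse_comp Hg'd (ps_bayesian_inverse_sym Hrdag)) Hg').
Qed.
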